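(* Let a random weighted iterated function system be given as in the context, with contraction factors $a_1(\omega),\dots,a_K(\omega)$, and let $D=\operatorname{ess\,sup}_{\omega\in\Omega_0} d_\omega$ and $d=\operatorname{ess\,inf}_{\omega\in\Omega_0} d_\omega$, where $d_\omega\ge 0$ is defined by $\sum_{j=1}^K a_j(\omega)^{d_\omega}=1$. Then almost surely $$\dim_A F_{\boldsymbol\omega}=D\quad\text{and}\quad\dim_L F_{\boldsymbol\omega}=d .$$
   Context: **Assouad dimensions.** Let $X$ be a bounded metric space (here $X=[0,1]$), $B(x,R)$ the open ball with centre $x$ and radius $R$, and $N_r(E)$ the least number of open balls of radius $r$ needed to cover $E\subseteq X$. The upper Assouad dimension $\dim_A E$ and lower Assouad dimension $\dim_L E$ of $E\subseteq X$ are the upper and lower $\Phi$-dimensions for $\Phi=0$: $\dim_A E$ is the infimum of all $d$ for which there are $C_1,C_2>0$ such that $N_r(B(z,R)\cap E)\le C_2(R/r)^d$ for all $0<r\le R<C_1$ and all $z\in E$; $\dim_L E$ is the supremum of all $d$ for which there are $C_1,C_2>0$ such that $N_r(B(z,R)\cap E)\ge C_2(R/r)^d$ for all $0<r\le R<C_1$ and all $z\in E$. **Random weighted iterated function system.** Let $(\Omega_0,P)$ be a probability space, $K\ge2$ an integer, and $A,B,\tau>0$ constants with $0<KA\le B<1$ and $\tau\le(1-B)/K$. For each $\omega\in\Omega_0$, $\mathcal I_\omega=\{S_1(\omega),\dots,S_K(\omega)\}$ is an iterated function system of $K$ similarities mapping $[0,1]$ into itself; $S_j(\omega)$ has contraction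 factor $a_j(\omega)$ (a random variable), with $A\le a_j(\omega)\le\sum_{i=1}^K a_i(\omega)\le B$ for all $j,\omega$, and the distance between $S_i(\omega)[0,1]$ and $S_j(\omega)[0,1]$ is at least $\tau$ for all $i\ne j$ and all $\omega$. Each $\mathcal I_\omega$ comes with probability weights $p_1(\omega),\dots,p_K(\omega)\ge0$ (random variables) with $\sum_i p_i(\omega)=1$, such that for some $t>0$, $\mathbb E_\omega(p_i(\omega)^{-t})<\infty$ for each $i$ (the weights play no role in the definition of the random set). **Random set.** Let $\Omega=\Omega_0^{\mathbb N}$ with the infinite product measure $\mathbb P$. For $\boldsymbol\omega=(\boldsymbol\omega_1,\boldsymbol\omega_2,\dots)\in\Omega$ put $I_{i_1,\dots,i_n}(\boldsymbol\omega)=S_{i_1}(\boldsymbol\omega_1)\circ\cdots\circ S_{i_n}(\boldsymbol\omega_n)[0,1]$. The random Moran set is $F_{\boldsymbol\omega}=\bigcap_n\bigcup_{i_1,\dots,i_n\in\{1,\dots,K\}}I_{i_1,\dots,i_n}(\boldsymbol\omega)$. ''Almost surely'' refers to $\mathbb P$; essential suprema/infima over $\Omega_0$ are with respect to $P$. *)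

(* Defs.v *)
From HB Require Import structures.
From mathcomp Require Import all_boot all_order all_algebra.
From mathcomp Require Import all_classical all_reals all_analysis.

Set Implicit Arguments.
Unset Strict Implicit.
Unset Printing Implicit Defensive.

Import Order.TTheory GRing.Theory Num.Theory.
Import numFieldNormedType.Exports.

Local Open Scope classical_set_scope.
Local Open Scope ring_scope.

Section assouad.
Variable R : realType.
Implicit Types X E : set R.

(* For the norm structure of [R], [ball x r] is the open ball of centre [x] and
   radius [r].  The value is [+oo] when there is no finite cover. *)
Definition covering_number X (r : R) E : \bar R :=
  ereal_inf [set n%:R%:E | n in [set n : nat | exists c : 'I_n -> R,
    (forall i, X (c i)) /\ E `<=` \bigcup_(i in [set: 'I_n]) ball (c i) r]].

Definition upper_assouad_dim X E : \bar R :=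
  ereal_inf [set s%:E | s in [set s : R | exists C1 C2 : R,
    [/\ 0 < C1, 0 < C2 & forall r rho z,
      0 < r -> r <= rho -> rho < C1 -> E z ->
      (covering_number X r (ball z rho `&` E) <= (C2 * (rho / r) `^ s)%:E)%E]]].

Definition lower_assouad_dim X E : \bar R :=
  ereal_sup [set s%:E | s in [set s : R | exists C1 C2 : R,
    [/\ 0 < C1, 0 < C2 & forall r rho z,
      0 < r -> r <= rho -> rho < C1 -> E z ->
      ((C2 * (rho / r) `^ s)%:E <= covering_number X r (ball z rho `&` E))%E]]].

End assouad.

(* The type of sequences, carrying the product sigma-algebra, i.e. the one
   generated by the coordinate maps. *)
Definition sequence_space (T : Type) := nat -> T.

Definition coordinate_sets d (T : measurableType d) :
    set (set (sequence_space T)) :=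
  [set A | exists n (B : set T), measurable B /\ A = (fun w => w n) @^-1` B].
Arguments coordinate_sets {d} T.

Definition sequence_display : measure_display -> measure_display.
Proof. exact. Qed.

Section sequence_space_measurable.
Context d (T : measurableType d).

HB.instance Definition _ := Pointed.copy (sequence_space T) (nat -> T).

Let sequence_setC A :
  <<s coordinate_sets T >> A -> <<s coordinate_sets T >> (~` A).
Proof. by move=> sA; rewrite -setTD; exact: sigma_algebraCD. Qed.

HB.instance Definition _ := @isMeasurable.Build (sequence_display d)
  (sequence_space T) <<s coordinate_sets T >>
  (@sigma_algebra0 _ setT (coordinate_sets T)) sequence_setC
  (@sigma_algebra_bigcup _ setT (coordinate_sets T)).

End sequence_space_measurable.

(* The defining property of the infinite product of [P] with itself.  Finite
   cylinders with measurable sides form a pi-system generating the product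
   sigma-algebra, so at most one probability satisfies it. *)
Definition is_infinite_product d (T : measurableType d) (R : realType)
    (P : probability T R) (PP : probability (sequence_space T) R) : Prop :=
  forall (n : nat) (B : 'I_n -> set T), (forall k, measurable (B k)) ->
    PP [set w : sequence_space T | forall k : 'I_n, B k (w k)] =
    (\prod_(k < n) P (B k))%E.

(* The maps [ifs_map j w] are only constrained on the unit interval. *)
Record random_weighted_ifs d (T : measurableType d) (R : realType)
    (P : probability T R) (K : nat) (A B tau : R) := RandomWeightedIFS {
  ifs_map : 'I_K -> T -> R -> R ;
  ifs_ratio : 'I_K -> {RV P >-> R} ;
  ifs_weight : 'I_K -> {RV P >-> R} ;
  ifs_map_itv : forall j w, ifs_map j w @` `[0, 1] `<=` `[0, 1] ;
  ifs_map_similarity : forall j w x y, `[0, 1]%classic x -> `[0, 1]%classic y ->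
    `|ifs_map j w x - ifs_map j w y| = ifs_ratio j w * `|x - y| ;
  ifs_ratio_ge : forall j w, A <= ifs_ratio j w ;
  ifs_ratio_le_sum : forall j w, ifs_ratio j w <= \sum_(i < K) ifs_ratio i w ;
  ifs_ratio_sum_le : forall w, \sum_(i < K) ifs_ratio i w <= B ;
  ifs_map_separated : forall i j w, i != j ->
    forall x y, `[0, 1]%classic x -> `[0, 1]%classic y ->
    tau <= `|ifs_map i w x - ifs_map j w y| ;
  ifs_weight_ge0 : forall j w, 0 <= ifs_weight j w ;
  ifs_weight_sum : forall w, \sum_(i < K) ifs_weight i w = 1 ;
  (* The inverse is taken in [\bar R], where [0^-1 = +oo]. *)
  ifs_weight_moment : exists2 t : R, 0 < t &
    forall i, (\int[P]_w ((ifs_weight i w `^ t)%:E)^-1 < +oo)%E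
}.

Section random_moran_set.
Context d (T : measurableType d) (R : realType) (P : probability T R).
Context (K : nat) (A B tau : R) (I : random_weighted_ifs P K A B tau).

(* The composite S_(i_1)(w_1) o ... o S_(i_n)(w_n), indices starting at 0. *)
Definition word_map (w : sequence_space T) n (i : n.-tuple 'I_K) : R -> R :=
  \big[(fun f g : R -> R => f \o g)/idfun]_(k < n)
    ifs_map I (tnth i k) (w k).

Definition random_moran_set (w : sequence_space T) : set R :=
  \bigcap_(n in [set n | (0 < n)%N])
    \bigcup_(i in [set: n.-tuple 'I_K]) word_map w i @` `[0, 1].

End random_moran_set.

(* Main.v *)
Require Import Defs.
From HB Require Import structures.
From mathcomp Require Import all_boot all_order all_algebra.
From mathcomp Require Import all_classical all_reals all_analysis ess_sup_inf.
From mathcomp Require Import measurable_realfun.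
From mathcomp Require Import ring lra.

Set Implicit Arguments.
Unset Strict Implicit.
Unset Printing Implicit Defensive.

Import Order.TTheory GRing.Theory Num.Theory.
Import numFieldNormedType.Exports.

Local Open Scope classical_set_scope.
Local Open Scope ring_scope.

(** Write a_j(k) for the ratios used at level k, and call sum_j a_j(k)^s the
    power sum of level k with exponent s. It decreases in s and equals 1 at the
    similarity dimension of level k, so it is at most 1 when that dimension is
    at most s and at least 1 when it is at least s.

    The covering numbers of the Moran set F see the ratios only through these
    sums. Because the images of [0, 1] under the maps of one level are at
    mutual distance at least tau, a ball of radius rho centred in F meets F
    inside one cylinder of length comparable to rho and contains another such
    cylinder. The cylinder of length L at level n splits into K cylinders of lengths a_j(n) L. Hence, if
    the power sums with exponent s are at most 1 at the levels involved, the
    bound N_r <= max 1 ((L / (A r))^s) passes from children to parent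
    ([piece_cover_le]); if they are at least 1, so does the bound
    N_r >= (tau L / (2 r))^s, since a ball of radius r with 2 r < tau L meets
    at most one child ([piece_cover_ge]). Only the levels between L and r
    matter.

    Let D and d be the essential bounds of the similarity dimension. Almost
    surely every level has dimension in [d, D], and the two bounds, used at all
    levels, give dim_A F <= D and d <= dim_L F ([upper_assouad_dim_le],
    [lower_assouad_dim_ge]). Conversely, for s < D the levels of dimension at
    least s have positive probability, so by independence arbitrarily long
    runs of consecutive such levels occur arbitrarily late ([ae_long_runs]).
    Such a run bounds the covering numbers from below by a constant times
    (rho / r)^s for arbitrarily large quotients rho / r at arbitrarily small
    scales, which forces s <= dim_A F ([upper_assouad_dim_ge]). The case of
    dim_L is symmetric ([lower_assouad_dim_le]). Letting s run through a
    sequence tending to D or d keeps the exceptional set null. *)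

(** * Similarities, powers and counting *)

Section real_preliminaries.
Variable R : realType.
Implicit Types (g : R -> R) (L x y e M B s t u : R).

(** On the line, the distances of g x to the two points g 0 and g 1 determine
    it, and the affine map with the same end values has the same distances. *)
Lemma similarity_lerp g L : 0 <= L ->
    (forall x y, 0 <= x <= 1 -> 0 <= y <= 1 -> `|g x - g y| = L * `|x - y|) ->
  forall x, 0 <= x <= 1 -> g x = g 0 + x * (g 1 - g 0).
Proof.
move=> L0 gL x /[dup] x01 /andP[x0 x1].
have h01 : 0 <= (0 : R) <= (1 : R) by apply/andP.
have h11 : 0 <= (1 : R) <= (1 : R) by apply/andP.
have := gL 1 0 h11 h01; have := gL x 0 x01 h01; have := gL 1 x h11 x01.
rewrite !subr0 normr1 mulr1 (ger0_norm x0) (@ger0_norm _ (1 - x)) ?subr_ge0//.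
rewrite mulrBr mulr1 => e1x ex0 e10.
have Lx0 : 0 <= L * x by rewrite mulr_ge0.
have LxL : L * x <= L by rewrite ler_piMr.
have [E|E] : g 1 - g 0 = L \/ g 1 - g 0 = - L.
- by rewrite -e10; case: (ger0P (g 1 - g 0)) => _; [left|right]; rewrite ?opprK.
- rewrite E [x * _]mulrC; move: e1x ex0.
  case: (ger0P (g 1 - g x)) => _; case: (ger0P (g x - g 0)) => _; lra.
- rewrite E mulrN [x * _]mulrC; move: e1x ex0.
  case: (ger0P (g 1 - g x)) => _; case: (ger0P (g x - g 0)) => _; lra.
Qed.

Lemma expr_small B e : 0 <= B -> B < 1 -> 0 < e -> exists n : nat, B ^+ n < e.
Proof.
move=> B0 B1 e0; have := @cvg_expr R B; rewrite ger0_norm// => /(_ B1).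
move=> /cvgrPdist_lt /(_ e e0) [n _ /(_ n (leqnn n))] /=.
by rewrite sub0r normrN normrX ger0_norm// => ?; exists n.
Qed.

Lemma powR_ge1 x s : 1 <= x -> 0 <= s -> 1 <= x `^ s.
Proof. by move=> x1 s0; rewrite -(powRr0 x) ler_powR. Qed.

Lemma powR_le1 x s : 0 <= x -> x <= 1 -> 0 <= s -> x `^ s <= 1.
Proof.
move=> x0 x1 s0; have := ge0_ler_powR s0 _ _ x1; rewrite powR1; apply.
  by rewrite nnegrE.
exact: ler01.
Qed.

Lemma powR_expn_small B s M : 0 < B -> B < 1 -> 0 < s -> 0 < M ->
  exists n : nat, (B ^+ n) `^ s < M.
Proof.
move=> B0 B1 s0 M0.
have Bs1 : B `^ s < 1.
  by have := gt0_ltr_powR s0 _ _ B1; rewrite powR1; apply; rewrite nnegrE ltW.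
have [n nM] := expr_small (powR_ge0 B s) Bs1 M0.
exists n; move: nM; rewrite -powR_mulrn ?powR_ge0// powRAC.
by rewrite (powR_mulrn n (ltW B0)).
Qed.

(** Exponents are compared along the single sequence of scales B^-n; this is how
    the dimension estimates over long runs are turned into inequalities. *)
Lemma powR_geometric_le B s t M : 0 < B -> B < 1 ->
  (forall n, (B ^- n) `^ s <= M * (B ^- n) `^ t) -> s <= t.
Proof.
move=> B0 B1 H; rewrite leNgt; apply/negP => ts.
have M0 : 0 < M.
  by have := H 0; rewrite expr0 invr1 !powR1 mulr1; exact: lt_le_trans.
have [n nM] : exists n, (B ^+ n) `^ (s - t) < M^-1.
  by apply: powR_expn_small; rewrite ?subr_gt0 ?invr_gt0.
have Bn0 : 0 < B ^+ n by rewrite exprn_gt0.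
have := H n; rewrite leNgt => /negP; apply.
have E u : (B ^- n) `^ u = (B ^+ n) `^ (- u).
  by rewrite -[B ^- n]powR_inv1 ?(ltW Bn0)// -powRrM mulN1r.
rewrite !E (_ : - t = - s + (s - t)); last by lra.
rewrite (@powRD _ (B ^+ n)); last first.
  by apply/implyP => _; rewrite gt_eqF.
rewrite mulrCA gtr_pMr ?powR_gt0//.
by rewrite -ltr_pdivlMl// mulr1.
Qed.

Lemma sum_count_le (T : Type) (J : finType) (P : J -> pred T) (s : seq T) :
    (forall c j j', P j c -> P j' c -> j = j') ->
  (\sum_j count (P j) s <= size s)%N.
Proof.
move=> Pj; elim: s => [|c s IH] /=; first by rewrite big1.
rewrite big_split/= -add1n leq_add//.
rewrite -big_mkcond/= sum1_card; apply/card_le1_eqP => j j'.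
by move=> pj pj'; symmetry; exact: Pj pj pj'.
Qed.

End real_preliminaries.

(** * Covering numbers *)

Section covering.
Variable R : realType.
Implicit Types (E X : set R) (s : seq R) (r : R).

(** Sequences of centres, unlike families indexed by ordinals, are easy to
    concatenate and to filter. *)
Definition seq_covers s r E :=
  forall x, E x -> exists2 c, c \in s & `|c - x| < r.

Lemma covering_number_le X r E s (M : R) :
    (forall c, c \in s -> X c) -> seq_covers s r E -> (size s)%:R <= M ->
  (covering_number X r E <= M%:E)%E.
Proof.
move=> sX sE sM; apply: (@le_trans _ _ (size s)%:R%:E); last by rewrite lee_fin.
apply: ereal_inf_lbound; exists (size s) => //.
exists (tnth (in_tuple s)); split=> [i|x /sE[c cs cx]]; first exact/sX/mem_tnth.
have /tnthP[i ci] : c \in in_tuple s by [].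
by exists i => //; rewrite -ball_normE /ball_/= -ci.
Qed.

Lemma covering_number_ge X r E (M : R) :
    (forall s, seq_covers s r E -> M <= (size s)%:R) ->
  (M%:E <= covering_number X r E)%E.
Proof.
move=> H; apply: le_ereal_inf_tmp => _ [n [c [_ cE]] <-]; rewrite lee_fin.
rewrite -[n in n%:R](size_enum_ord n) -(size_map c); apply: H => x /cE[i _].
rewrite -ball_normE /ball_/= => cx; exists (c i) => //.
by apply/map_f; rewrite mem_enum.
Qed.

Lemma seq_coversS s r E E' : E `<=` E' -> seq_covers s r E' -> seq_covers s r E.
Proof. by move=> EE' sE x /EE'; exact: sE. Qed.

End covering.

(** * Deterministic Moran constructions *)

(** A realization of the random system, with the maps of level k named f k j.
    Only the values on the unit interval are constrained. *)
Record moran_construction (R : realType) (K : nat) (A B tau : R)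
    (f : nat -> 'I_K -> R -> R) (a : nat -> 'I_K -> R) : Prop := {
  moran_ratio_min_gt0 : 0 < A ;
  moran_sum_max_lt1 : B < 1 ;
  moran_gap_gt0 : 0 < tau ;
  moran_gap_le1 : tau <= 1 ;
  moran_alphabet_gt0 : (0 < K)%N ;
  moran_map01 : forall k j (x : R), 0 <= x <= 1 -> 0 <= f k j x <= 1 ;
  moran_map_similarity : forall k j (x y : R), 0 <= x <= 1 -> 0 <= y <= 1 ->
    `|f k j x - f k j y| = a k j * `|x - y| ;
  moran_ratio_ge : forall k j, A <= a k j ;
  moran_sum_ratio_le : forall k, \sum_j a k j <= B ;
  moran_map_separated : forall k j j' (x y : R), j != j' ->
    0 <= x <= 1 -> 0 <= y <= 1 -> tau <= `|f k j x - f k j' y|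
}.

Section moran.
Variables (R : realType) (K : nat) (A B tau : R).
Variables (f : nat -> 'I_K -> R -> R) (a : nat -> 'I_K -> R).
Hypothesis fa : moran_construction A B tau f a.
Implicit Types (x y z c r s rho : R).

Let A0 : 0 < A := moran_ratio_min_gt0 fa.
Let B1 : B < 1 := moran_sum_max_lt1 fa.
Let tau0 : 0 < tau := moran_gap_gt0 fa.
Let tau_le1 : tau <= 1 := moran_gap_le1 fa.
Let K_gt0 : (0 < K)%N := moran_alphabet_gt0 fa.
Let f01 := moran_map01 fa.
Let f_similarity := moran_map_similarity fa.
Let a_ge := moran_ratio_ge fa.
Let sum_a_le := moran_sum_ratio_le fa.
Let f_separated := moran_map_separated fa.

Implicit Types (i : nat -> 'I_K) (n m k : nat).

(** Words of length n are represented by infinite addresses of which only the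
    first n digits are read. *)
Fixpoint cylinder_map i n : R -> R :=
  if n is m.+1 then cylinder_map i m \o f m (i m) else idfun.

Definition cylinder_diam i n : R := \prod_(k < n) a k (i k).

Definition cylinder i n := cylinder_map i n @` [set x : R | 0 <= x <= 1].

Definition coded_by i : set R := [set x | forall n, cylinder i n x].

(** The part of the Moran set lying in a cylinder. It is defined through
    addresses rather than as an intersection, so that its decomposition into
    the pieces of the next level does not depend on the separation of the
    cylinders. *)
Definition piece i n : set R :=
  [set x | exists2 i', (forall k, (k < n)%N -> i' k = i k) & coded_by i' x].

Definition moran_set : set R := [set x | exists i, coded_by i x].

Let a_gt0 k j : 0 < a k j. Proof. exact: lt_le_trans (a_ge k j). Qed.

Let a_leB k j : a k j <= B.
Proof.
apply: le_trans (sum_a_le k).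
by rewrite (bigD1 j)//= lerDl; apply: sumr_ge0 => ? _; exact: ltW.
Qed.

Lemma cylinder_diamS i n : cylinder_diam i n.+1 = cylinder_diam i n * a n (i n).
Proof. exact: big_ord_recr. Qed.

Lemma cylinder_diam_gt0 i n : 0 < cylinder_diam i n.
Proof. exact: prodr_gt0. Qed.

Lemma cylinder_diam_ge i n : A * cylinder_diam i n <= cylinder_diam i n.+1.
Proof. by rewrite cylinder_diamS mulrC ler_pM2l ?cylinder_diam_gt0. Qed.

Lemma cylinder_diam_leS i n : cylinder_diam i n.+1 <= cylinder_diam i n * B.
Proof. by rewrite cylinder_diamS ler_pM2l ?cylinder_diam_gt0. Qed.

Let B_gt0 : 0 < B.
Proof. exact: lt_le_trans (a_leB 0 (Ordinal K_gt0)). Qed.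

Lemma cylinder_diam_leX i n : cylinder_diam i n <= B ^+ n.
Proof.
elim: n => [|n IH]; first by rewrite /cylinder_diam big_ord0.
apply: le_trans (cylinder_diam_leS i n) _.
by rewrite exprSr ler_pM2r ?B_gt0.
Qed.

Lemma cylinder_diam_nincr i n m :
  (n <= m)%N -> cylinder_diam i m <= cylinder_diam i n.
Proof.
elim: m => [|m IH]; first by rewrite leqn0 => /eqP ->.
rewrite leq_eqVlt ltnS => /predU1P[->//|/IH]; apply: le_trans.
apply: le_trans (cylinder_diam_leS i m) _.
by rewrite ger_pMr ?cylinder_diam_gt0// ltW.
Qed.

Lemma cylinder_map01 i n x : 0 <= x <= 1 -> 0 <= cylinder_map i n x <= 1.
Proof. by elim: n x => [//|n IH] x x01 /=; apply: IH; exact: f01. Qed.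

Lemma cylinder_map_similarity i n x y : 0 <= x <= 1 -> 0 <= y <= 1 ->
  `|cylinder_map i n x - cylinder_map i n y| = cylinder_diam i n * `|x - y|.
Proof.
elim: n x y => [|n IH] x y x01 y01 /=.
  by rewrite /cylinder_diam big_ord0 mul1r.
by rewrite IH ?f01// f_similarity// cylinder_diamS mulrA.
Qed.

Lemma cylinder_diam_congr i i' n :
  (forall k, (k < n)%N -> i k = i' k) -> cylinder_diam i n = cylinder_diam i' n.
Proof. by move=> ii'; apply: eq_bigr => k _; rewrite ii'. Qed.

Lemma cylinder_map_congr i i' n :
  (forall k, (k < n)%N -> i k = i' k) -> cylinder_map i n = cylinder_map i' n.
Proof.
elim: n => [//|n IH] ii' /=; rewrite ii'// IH// => k kn.
by apply: ii'; rewrite ltnS ltnW.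
Qed.

Lemma cylinder_congr i i' n :
  (forall k, (k < n)%N -> i k = i' k) -> cylinder i n = cylinder i' n.
Proof. by move=> /cylinder_map_congr e; rewrite /cylinder e. Qed.

Lemma cylinder_subS i n : cylinder i n.+1 `<=` cylinder i n.
Proof. by move=> _ [x x01 <-]; exists (f n (i n) x) => //; exact: f01. Qed.

Lemma cylinder_sub i n m : (n <= m)%N -> cylinder i m `<=` cylinder i n.
Proof.
elim: m => [|m IH]; first by rewrite leqn0 => /eqP ->.
rewrite leq_eqVlt ltnS => /predU1P[->//|/IH nm].
exact: subset_trans (@cylinder_subS i m) nm.
Qed.

Lemma cylinder_dist i n x y :
  cylinder i n x -> cylinder i n y -> `|x - y| <= cylinder_diam i n.
Proof.
move=> [u /= u01 <-] [v /= v01 <-]; rewrite cylinder_map_similarity//.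
rewrite ger_pMr ?cylinder_diam_gt0// ler_norml.
by move: u01 v01 => /andP[h1 h2] /andP[h3 h4]; apply/andP; split; lra.
Qed.

Lemma cylinder_separated i i' n x y :
    (forall k, (k < n)%N -> i k = i' k) -> i n != i' n ->
    cylinder i n.+1 x -> cylinder i' n.+1 y ->
  tau * cylinder_diam i n <= `|x - y|.
Proof.
move=> ii' ne [u /= u01 <-] [v /= v01 <-].
rewrite -(cylinder_map_congr ii') cylinder_map_similarity ?f01//.
by rewrite mulrC ler_pM2l ?cylinder_diam_gt0// f_separated.
Qed.

(** At the first level where two addresses differ, the two points are already
    separated by tau times the length of their common cylinder, and that length
    only decreases afterwards. *)
Lemma coded_by_agree i i' n x y : coded_by i x -> coded_by i' y ->
    `|x - y| < tau * cylinder_diam i n ->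
  forall k, (k <= n)%N -> i' k = i k.
Proof.
move=> ix i'y xy; elim/ltn_ind => k IH kn; apply/eqP; apply: contraLR xy => ne.
rewrite -leNgt; apply: (@le_trans _ _ (tau * cylinder_diam i k)).
  by rewrite ler_pM2l// cylinder_diam_nincr.
apply: (cylinder_separated _ _ (ix k.+1) (i'y k.+1)); last by rewrite eq_sym.
by move=> l lk; rewrite IH// ltnW// (leq_trans lk).
Qed.

Lemma cylinder_agree i i' n x : cylinder i n x -> cylinder i' n x ->
  forall k, (k < n)%N -> i k = i' k.
Proof.
move=> ix i'x; elim/ltn_ind => k IH kn; apply/eqP/negPn/negP => ne.
have := cylinder_separated (fun l lk => IH l lk (ltn_trans lk kn)) ne
  (cylinder_sub kn ix) (cylinder_sub kn i'x).
by rewrite subrr normr0 leNgt mulr_gt0// cylinder_diam_gt0.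
Qed.

(** The words of the cylinders containing x are prefixes of each other, as
    cylinders with different words of the same length are disjoint; their last
    digits therefore form an address of x. *)
Lemma moran_setE : moran_set = [set x | forall n, exists i, cylinder i n x].
Proof.
apply/seteqP; split => x /=; first by move=> [i ix] n; exists i.
move=> /choice[u ux]; exists (fun k => u k.+1 k) => n.
rewrite (@cylinder_congr _ (u n))// => k kn.
exact: cylinder_agree (ux k.+1) (cylinder_sub kn (ux n)) _ (ltnSn k).
Qed.

(** By affinity each cylinder is the closed interval between the images of 0
    and 1, so the supremum of the left ends of nested cylinders lies in all of
    them. *)
Lemma coded_by_nonempty i : coded_by i !=set0.
Proof.
pose g := cylinder_map i.
pose lo n := Num.min (g n 0) (g n 1); pose hi n := Num.max (g n 0) (g n 1).
have h0 : 0 <= (0 : R) <= (1 : R) by apply/andP.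
have h1 : 0 <= (1 : R) <= (1 : R) by apply/andP.
have glerp n x : 0 <= x <= 1 -> g n x = g n 0 + x * (g n 1 - g n 0).
  apply: (@similarity_lerp _ _ (cylinder_diam i n)).
  - exact/ltW/cylinder_diam_gt0.
  - exact: cylinder_map_similarity.
have loC n : cylinder i n (lo n).
  by rewrite /lo; case: leP => _; [exists 0|exists 1].
have cyl_itv n y : cylinder i n y -> lo n <= y <= hi n.
  move=> [x /[dup] x01 /andP[x0 x1] <-].
  have x1' : 0 <= 1 - x by rewrite subr_ge0.
  rewrite -/(g n) glerp// /lo /hi; case: (leP (g n 0) (g n 1)) => [h|/ltW h].
    have d0 : 0 <= g n 1 - g n 0 by rewrite subr_ge0.
    have := mulr_ge0 x0 d0; have := mulr_ge0 x1' d0.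
    by move=> ? ?; apply/andP; split; lra.
  have d0 : 0 <= g n 0 - g n 1 by rewrite subr_ge0.
  have := mulr_ge0 x0 d0; have := mulr_ge0 x1' d0.
  by move=> ? ?; apply/andP; split; lra.
have itv_cyl n y : lo n <= y <= hi n -> cylinder i n y.
  have [e|ne] := eqVneq (g n 0) (g n 1).
    by rewrite /lo /hi e minxx maxxx -eq_le => /eqP <-; exists 1.
  move=> lh; have ne0 : g n 1 - g n 0 != 0 by rewrite subr_eq0 eq_sym.
  have x01 : 0 <= (y - g n 0) / (g n 1 - g n 0) <= 1.
    move: lh ne0; rewrite /lo /hi.
    case: (leP (g n 0) (g n 1)) => h /andP[l u] ne0.
      have p0 : 0 < g n 1 - g n 0 by rewrite lt_neqAle eq_sym ne0 subr_ge0.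
      by rewrite divr_ge0 ?subr_ge0// ler_pdivrMr// mul1r lerD2r.
    have p0 : g n 1 - g n 0 < 0 by rewrite subr_lt0.
    by rewrite ler_ndivrMr// mul1r lerD2r l ler_ndivlMr// mul0r subr_le0 u.
  exists ((y - g n 0) / (g n 1 - g n 0)) => //.
  by rewrite -/(g n) glerp// divfK// addrC subrK.
have lohi n m : lo m <= hi n.
  have [nm|/ltnW mn] := leqP n m.
    by have /(cylinder_sub nm)/cyl_itv/andP[] := loC m.
  have /(cylinder_sub mn)/cyl_itv/andP[h _] := loC n.
  by apply: le_trans h _; have /cyl_itv/andP[] := loC n.
have lo_sup : has_sup (range lo).
  by split; [exists (lo 0), 0|exists (hi 0) => _ [m _ <-]].
exists (sup (range lo)) => n; apply: itv_cyl; apply/andP; split.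
  by apply: ub_le_sup; [exact: lo_sup.2|exists n].
by apply: ge_sup; [exact: lo_sup.1|move=> _ [m _ <-]].
Qed.

Definition set_digit i n (j : 'I_K) : nat -> 'I_K :=
  fun k => if k == n then j else i k.

Lemma set_digitE i n j : set_digit i n j n = j.
Proof. by rewrite /set_digit eqxx. Qed.

Lemma set_digit_lt i n j k : (k < n)%N -> set_digit i n j k = i k.
Proof. by rewrite /set_digit => /ltn_eqF ->. Qed.

Lemma piece_set_digit i n x :
  piece i n x <-> exists j, piece (set_digit i n j) n.+1 x.
Proof.
split=> [[i' ii' i'x]|[j [i' ii' i'x]]]; last first.
  by exists i' => // k kn; rewrite ii' ?set_digit_lt// ltnS ltnW.
exists (i' n); exists i' => // k; rewrite ltnS leq_eqVlt => /predU1P[->|kn].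
  by rewrite set_digitE.
by rewrite set_digit_lt// ii'.
Qed.

Lemma set_digit_diam i n j :
  cylinder_diam (set_digit i n j) n.+1 = cylinder_diam i n * a n j.
Proof.
rewrite cylinder_diamS set_digitE; congr (_ * _).
by apply: cylinder_diam_congr => k; exact: set_digit_lt.
Qed.

Lemma piece_nonempty i n : piece i n !=set0.
Proof. by have [x ix] := coded_by_nonempty i; exists x, i. Qed.

Lemma piece_cylinder i n : piece i n `<=` cylinder i n.
Proof. by move=> x [i' /cylinder_congr <-]. Qed.

Lemma piece_moran i n : piece i n `<=` moran_set.
Proof. by move=> x [i' _ i'x]; exists i'. Qed.

(** A ball of radius at most tau times the length of a cylinder containing its
    centre cannot even reach a second child of this cylinder. *)
Lemma ball_piece i n z rho : coded_by i z -> rho <= tau * cylinder_diam i n ->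
  ball z rho `&` moran_set `<=` piece i n.+1.
Proof.
move=> iz rn x [zx [i' i'x]]; exists i' => // k; rewrite ltnS => kn.
apply: (coded_by_agree iz i'x _ kn).
by apply: lt_le_trans rn; move: zx; rewrite -ball_normE.
Qed.

Lemma piece_ball i n z rho : coded_by i z -> cylinder_diam i n < rho ->
  piece i n `<=` ball z rho `&` moran_set.
Proof.
move=> iz rn x px; split; last exact: piece_moran px.
rewrite -ball_normE /ball_/=; apply: le_lt_trans rn.
exact: cylinder_dist (iz n) (piece_cylinder px).
Qed.

(** Centring at the middle of the cylinder leaves room for the balls to be
    open when the length is exactly r. *)
Lemma seq_covers_le1 i n r : cylinder_diam i n <= r -> 0 < r ->
  exists c, 0 <= c <= 1 /\ seq_covers [:: c] r (piece i n).
Proof.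
move=> ir r0; have h2 : 0 <= (2^-1 : R) <= (1 : R) by apply/andP; split; lra.
exists (cylinder_map i n 2^-1); split; first exact: cylinder_map01.
move=> x /piece_cylinder[u /= u01 <-]; exists (cylinder_map i n 2^-1).
  by rewrite mem_head.
rewrite cylinder_map_similarity//.
have u2 : `|2^-1 - u| <= 2^-1.
  by move: u01 => /andP[u0 u1]; rewrite ler_norml; apply/andP; split; lra.
have := cylinder_diam_gt0 i n; nra.
Qed.

(** Induction on the number m of levels needed to get below length r. A cylinder
    of length at most r needs one ball. Otherwise its children have length at
    least A r, so that for them the maximum is attained by the power, and the
    bounds of the children add up to at most that of the parent because the
    power sum is at most 1. *)
Lemma piece_cover_le s r m i n : 0 < r -> 0 <= s ->
    (forall k, (n <= k < n + m)%N -> \sum_j a k j `^ s <= 1) ->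
    cylinder_diam i n * B ^+ m <= r ->
  exists t : seq R, [/\ (forall c, c \in t -> 0 <= c <= 1),
    seq_covers t r (piece i n) &
    (size t)%:R <= Num.max 1 ((cylinder_diam i n / (A * r)) `^ s)].
Proof.
move=> r0 s0; elim: m i n => [|m IH] i n Hs.
  rewrite expr0 mulr1 => ir; have [c [c01 cc]] := seq_covers_le1 ir r0.
  by exists [:: c]; split=> //= [x|]; rewrite ?inE ?le_max ?lexx// => /eqP ->.
move=> iB; have [ir|ri] := leP (cylinder_diam i n) r.
  have [c [c01 cc]] := seq_covers_le1 ir r0.
  by exists [:: c]; split=> //= [x|]; rewrite ?inE ?le_max ?lexx// => /eqP ->.
have /choice[t tP] (j : 'I_K) : exists t : seq R,
    [/\ (forall c, c \in t -> 0 <= c <= 1),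
    seq_covers t r (piece (set_digit i n j) n.+1) &
    (size t)%:R <= (cylinder_diam i n / (A * r)) `^ s * a n j `^ s].
  have := IH (set_digit i n j) n.+1; rewrite set_digit_diam; case.
  - by move=> k /andP[nk km]; apply: Hs; rewrite ltnW//= addnS -addSn.
  - apply: le_trans iB; rewrite exprS mulrA ler_pM2r ?exprn_gt0 ?B_gt0//.
    by rewrite ler_pM2l ?cylinder_diam_gt0.
  - move=> t [t01 tc ts]; exists t; split=> //.
    rewrite -powRM ?(ltW (a_gt0 _ _))//; last first.
      by rewrite divr_ge0 ?ltW ?cylinder_diam_gt0 ?mulr_gt0.
    rewrite [X in X `^ s]mulrAC; apply: le_trans ts _; rewrite ge_max lexx andbT.
    apply: powR_ge1 => //.
    rewrite ler_pdivlMr ?mulr_gt0// mul1r [leRHS]mulrC.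
    by rewrite ler_pM ?(ltW A0) ?(ltW r0) ?(ltW ri).
exists (flatten [seq t j | j <- enum 'I_K]); split.
- by move=> c /flattenP[_ /mapP[j _ ->]]; have [+ _ _] := tP j; apply.
- move=> x /piece_set_digit[j xj]; have [_ /(_ x xj)[c ct cx] _] := tP j.
  exists c => //; apply/flattenP; exists (t j) => //.
  by apply/mapP; exists j => //; rewrite mem_enum.
- rewrite size_flatten /shape -map_comp sumnE big_map big_enum/= natr_sum.
  rewrite le_max; apply/orP; right.
  apply: (@le_trans _ _
    (\sum_j (cylinder_diam i n / (A * r)) `^ s * a n j `^ s)).
    by apply: ler_sum => j _; have [] := tP j.
  rewrite -mulr_sumr ger_pMr ?powR_gt0 ?divr_gt0 ?mulr_gt0 ?cylinder_diam_gt0//.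
  by apply: Hs; rewrite leqnn/= addnS ltnS leq_addr.
Qed.

(** Induction on the number m of levels needed to get below length 2 r / tau.
    Under this length the bound is at most 1. Above it, no ball of radius r
    meets two children, so the numbers of balls meeting each of them add up to
    at most the size of the cover. *)
Lemma piece_cover_ge s r m i n : 0 < r -> 0 <= s ->
    (forall k, (n <= k < n + m)%N -> 1 <= \sum_j a k j `^ s) ->
    tau * cylinder_diam i n * B ^+ m <= 2 * r ->
  forall t, seq_covers t r (piece i n) ->
    (tau * cylinder_diam i n / (2 * r)) `^ s <= (size t)%:R.
Proof.
move=> r0 s0; have r20 : 0 < 2 * r by rewrite mulr_gt0.
have base i' n' t : tau * cylinder_diam i' n' <= 2 * r ->
    seq_covers t r (piece i' n') ->
    (tau * cylinder_diam i' n' / (2 * r)) `^ s <= (size t)%:R.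
  move=> ir tc; have [x px] := piece_nonempty i' n'.
  have [c ct _] := tc x px; apply: (@le_trans _ _ 1).
    apply: powR_le1 => //; last by rewrite ler_pdivrMr// mul1r.
    by rewrite divr_ge0 ?mulr_ge0 ?ltW ?cylinder_diam_gt0.
  by rewrite ler1n; case: t tc ct.
elim: m i n => [|m IH] i n Hs.
  by rewrite expr0 mulr1 => ir t; exact: base.
move=> iB t tc; have [ir|ri] := leP (tau * cylinder_diam i n) (2 * r).
  exact: base.
pose P j c := `[< exists2 x, piece (set_digit i n j) n.+1 x & `|c - x| < r >].
apply: (@le_trans _ _ (\sum_j count (P j) t)%N%:R); last first.
  rewrite ler_nat; apply: sum_count_le => c j j'.
  move=> /asboolP[x xj cx] /asboolP[y yj' cy]; apply/eqP.
  apply: contraLR (ri) => ne; rewrite -leNgt.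
  have ejj' k : (k < n)%N -> set_digit i n j k = set_digit i n j' k.
    by move=> kn; rewrite !set_digit_lt.
  have := cylinder_separated ejj' _ (piece_cylinder xj) (piece_cylinder yj').
  rewrite !set_digitE => /(_ ne).
  rewrite (@cylinder_diam_congr _ i); last by move=> k; exact: set_digit_lt.
  move=> sep; apply: le_trans sep _; move: cx cy.
  rewrite !ltr_norml ler_norml => /andP[h1 h2] /andP[h3 h4].
  by apply/andP; split; lra.
have tau_diam : 0 <= tau * cylinder_diam i n.
  by rewrite mulr_ge0 ?ltW ?cylinder_diam_gt0.
apply: (@le_trans _ _
  (\sum_j (tau * cylinder_diam i n / (2 * r)) `^ s * a n j `^ s)).
  rewrite -mulr_sumr ler_peMr ?powR_ge0//.
  by apply: Hs; rewrite leqnn/= addnS ltnS leq_addr.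
rewrite natr_sum; apply: ler_sum => j _; rewrite -size_filter.
rewrite -powRM ?(ltW (a_gt0 _ _)) ?divr_ge0 ?(ltW r20)//.
have -> : tau * cylinder_diam i n / (2 * r) * a n j =
    tau * cylinder_diam (set_digit i n j) n.+1 / (2 * r).
  by rewrite set_digit_diam [in RHS]mulrA [LHS]mulrAC.
apply: IH.
- by move=> k /andP[nk km]; apply: Hs; rewrite ltnW//= addnS -addSn.
- apply: le_trans iB; rewrite set_digit_diam exprS !mulrA.
  rewrite ler_pM2r ?exprn_gt0 ?B_gt0//.
  by rewrite ler_pM2l ?mulr_gt0 ?cylinder_diam_gt0.
move=> x xj; have [|c ct cx] := tc x; first by apply/piece_set_digit; exists j.
by exists c => //; rewrite mem_filter ct andbT; apply/asboolP; exists x.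
Qed.

Lemma piece_subS i n : piece i n.+1 `<=` piece i n.
Proof. by move=> x [i' ii' i'x]; exists i' => // k kn; rewrite ii'// ltnW. Qed.

Let A_le1 : A <= 1.
Proof.
apply: le_trans (ltW B1); exact: le_trans (a_ge 0 _) (a_leB 0 (Ordinal K_gt0)).
Qed.

Let tauA_gt0 : 0 < tau * A. Proof. exact: mulr_gt0. Qed.

Let tauA_le1 : tau * A <= 1.
Proof. by apply: mulr_ile1 => //; exact: ltW. Qed.

Lemma moran_set_nonempty : moran_set !=set0.
Proof.
have [x xi] := coded_by_nonempty (fun=> Ordinal K_gt0).
by exists x, (fun=> Ordinal K_gt0).
Qed.

(** The lengths along an address decrease from 1 to 0; as consecutive ones differ
    at most by the factor A, every scale is realized up to this factor. *)
Lemma cylinder_diam_scale i c : 0 < c <= 1 ->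
  exists n, cylinder_diam i n.+1 < c <= cylinder_diam i n.
Proof.
move=> /andP[c0 c1]; have [n nc] := expr_small (ltW B_gt0) B1 c0.
have ex : exists n, cylinder_diam i n < c.
  by exists n; exact: le_lt_trans (cylinder_diam_leX i n) nc.
case: (ex_minnP ex) => -[|m] mc mmin.
  by move: mc; rewrite /cylinder_diam big_ord0 ltNge c1.
by exists m; rewrite mc leNgt; apply/negP => /mmin; rewrite ltnn.
Qed.

Let itv01 c : 0 <= c <= 1 -> `[0, 1]%classic c.
Proof. by rewrite /= in_itv. Qed.

(** The cylinder of the centre whose length is just below rho / tau contains
    all the points of the Moran set in the ball, and [piece_cover_le] bounds its
    covering number at every scale. *)
Lemma upper_assouad_dim_le s : 0 <= s ->
    (forall k, \sum_j a k j `^ s <= 1) ->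
  (upper_assouad_dim `[0%R, 1%R] moran_set <= s%:E)%E.
Proof.
move=> s0 Hs; apply: ereal_inf_lbound; exists s => //.
exists tau, (((tau * A)^-1) `^ s); split; rewrite ?powR_gt0 ?invr_gt0//.
move=> r rho z r0 rrho rhotau [i iz].
have rho0 : 0 < rho by exact: lt_le_trans rrho.
have [|n /andP[Ln nL]] := @cylinder_diam_scale i (rho / tau).
  by rewrite divr_gt0//= ler_pdivrMr// mul1r ltW.
have [m mr] := expr_small (ltW B_gt0) B1 r0.
have [||t [t01 tc tsize]] := @piece_cover_le s r m i n.+1 r0 s0.
- by move=> k _; exact: Hs.
- apply: le_trans (ltW mr); rewrite ger_pMl ?exprn_gt0//.
  apply: le_trans (cylinder_diam_leX _ _) _.
  by apply: exprn_ile1; exact: ltW.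
apply: (covering_number_le (s := t)).
- by move=> c /t01/itv01.
- apply: seq_coversS tc; apply: ball_piece => //.
  by rewrite mulrC -ler_pdivrMr.
have tauA1 : 1 <= (tau * A)^-1.
  by rewrite invf_ge1.
have rr1 : 1 <= rho / r by rewrite ler_pdivlMr// mul1r.
rewrite -powRM ?invr_ge0 ?divr_ge0 ?(ltW tauA_gt0) ?(ltW rho0) ?(ltW r0)//.
apply: le_trans tsize _; rewrite ge_max; apply/andP; split.
  by apply: powR_ge1 => //; rewrite mulr_ege1.
apply: ge0_ler_powR => //.
- by rewrite nnegrE divr_ge0 ?mulr_ge0 ?ltW ?cylinder_diam_gt0.
- by rewrite nnegrE mulr_ge0 ?invr_ge0 ?divr_ge0 ?ltW.
have -> : (tau * A)^-1 * (rho / r) = (rho / tau) / (A * r).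
  by field; rewrite !gt_eqF.
by rewrite ler_pM2r ?invr_gt0 ?mulr_gt0// ltW.
Qed.

(** The cylinder of the centre whose length is just below rho is contained in
    the ball, and its length is at least A rho. *)
Lemma lower_assouad_dim_ge s : 0 <= s ->
    (forall k, 1 <= \sum_j a k j `^ s) ->
  (s%:E <= lower_assouad_dim `[0%R, 1%R] moran_set)%E.
Proof.
move=> s0 Hs; apply: ereal_sup_ubound; exists s => //.
exists 1, ((tau * A / 2) `^ s); split; rewrite ?powR_gt0 ?divr_gt0//.
move=> r rho z r0 rrho rho1 [i iz].
have rho0 : 0 < rho by exact: lt_le_trans rrho.
have [|n /andP[Ln nL]] := @cylinder_diam_scale i rho.
  by rewrite rho0 ltW.
have r20 : 0 < 2 * r by rewrite mulr_gt0.
have [m mr] := expr_small (ltW B_gt0) B1 r20.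
apply: covering_number_ge => t tc.
rewrite -powRM ?divr_ge0 ?(ltW tauA_gt0) ?(ltW rho0) ?(ltW r0)//.
have := @piece_cover_ge s r m i n.+1 r0 s0 (fun k _ => Hs k) _ t.
move=> H; apply: le_trans (H _ _).
- apply: ge0_ler_powR => //.
  + by rewrite nnegrE mulr_ge0 ?divr_ge0 ?ltW.
  + by rewrite nnegrE divr_ge0 ?mulr_ge0 ?ltW ?cylinder_diam_gt0.
  rewrite mulrACA -invfM ler_pM2r ?invr_gt0// -mulrA ler_pM2l//.
  apply: le_trans (cylinder_diam_ge i n).
  by rewrite ler_pM2l.
- apply: le_trans (ltW mr); rewrite ger_pMl ?exprn_gt0//.
  rewrite mulr_ile1 ?(ltW tau0) ?(ltW (cylinder_diam_gt0 _ _))//.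
  apply: le_trans (cylinder_diam_leX _ _) _.
  by apply: exprn_ile1; exact: ltW.
- by apply: seq_coversS tc; apply: piece_ball.
Qed.

(** At the cylinder of length L where a late run of n good levels starts, the
    radii rho = 2 L and r = tau L B^n / 2 have quotient (4 / tau) B^-n, while at
    least (B^-n)^s balls are needed. As n is arbitrary, no exponent t < s is
    admissible; the run starts late to bring rho below the threshold C1. *)
Lemma upper_assouad_dim_ge s : 0 <= s ->
    (forall N M, exists2 k, (M <= k)%N &
       forall l, (k <= l < k + N)%N -> 1 <= \sum_j a l j `^ s) ->
  (s%:E <= upper_assouad_dim `[0%R, 1%R] moran_set)%E.
Proof.
move=> s0 Hs; apply: le_ereal_inf_tmp => _ [t [C1 [C2 [C10 C20 H]]] <-].
rewrite lee_fin.
apply: (@powR_geometric_le _ B s t (C2 * (4 / tau) `^ t)) => // n.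
have [z [i iz]] := moran_set_nonempty.
have [M MC] := expr_small (ltW B_gt0) B1 (divr_gt0 C10 (ltr0n _ 2)).
have [k Mk run] := Hs n M.
have L0 := cylinder_diam_gt0 i k; have Bn0 : 0 < B ^+ n by rewrite exprn_gt0.
have Bn1 : B ^+ n <= 1 by apply: exprn_ile1; exact: ltW.
set L := cylinder_diam i k in L0.
have r0 : 0 < tau * L * B ^+ n / 2 by rewrite divr_gt0 ?mulr_gt0.
have rrho : tau * L * B ^+ n / 2 <= 2 * L.
  apply: (@le_trans _ _ (L / 2)); last by lra.
  rewrite ler_pM2r// mulrAC ger_pMl//.
  by apply: mulr_ile1 => //; exact: ltW.
have rhoC : 2 * L < C1.
  have LM : L <= B ^+ M.
    apply: le_trans (cylinder_diam_leX i M).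
    exact: cylinder_diam_nincr.
  move: MC; rewrite ltr_pdivlMr//; lra.
have zF : moran_set z by exists i.
have := H _ _ z r0 rrho rhoC zF.
have -> : 2 * L / (tau * L * B ^+ n / 2) = 4 / tau * B ^- n.
  by field; rewrite !gt_eqF.
rewrite powRM ?divr_ge0 ?invr_ge0 ?(ltW tau0) ?(ltW Bn0)// mulrA -lee_fin.
apply: le_trans; apply: covering_number_ge => c cc.
have -> : B ^- n = tau * L / (2 * (tau * L * B ^+ n / 2)).
  by field; rewrite !gt_eqF.
apply: (@piece_cover_ge s _ n i k) => //.
- by rewrite [leRHS]mulrC divfK.
- by apply: seq_coversS cc; apply: piece_ball => //; rewrite -/L; lra.
Qed.

(** At the cylinder of length L where a late run of good levels starts, take
    rho = tau L, for which the ball stays in the cylinder, and r = B^n rho. Some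
    n0 more levels of the run, with B^n0 < tau, absorb the factor tau. *)
Lemma lower_assouad_dim_le s : 0 <= s ->
    (forall N M, exists2 k, (M <= k)%N &
       forall l, (k <= l < k + N)%N -> \sum_j a l j `^ s <= 1) ->
  (lower_assouad_dim `[0%R, 1%R] moran_set <= s%:E)%E.
Proof.
move=> s0 Hs; apply: ge_ereal_sup => _ [t [C1 [C2 [C10 C20 H]]] <-].
rewrite lee_fin.
apply: (@powR_geometric_le _ B t s (C2^-1 * (tau * A)^-1 `^ s)) => // n.
have [z [i iz]] := moran_set_nonempty.
have [M MC] := expr_small (ltW B_gt0) B1 C10.
have [n0 n0tau] := expr_small (ltW B_gt0) B1 tau0.
have [k Mk run] := Hs (n + n0)%N M.
have L0 := cylinder_diam_gt0 i k; have Bn0 : 0 < B ^+ n by rewrite exprn_gt0.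
have Bn1 : B ^+ n <= 1 by apply: exprn_ile1; exact: ltW.
set L := cylinder_diam i k in L0.
have r0 : 0 < tau * L * B ^+ n by rewrite ?mulr_gt0.
have rrho : tau * L * B ^+ n <= tau * L by rewrite ger_pMr ?mulr_gt0.
have rhoC : tau * L < C1.
  apply: le_lt_trans MC; apply: (@le_trans _ _ L); first by rewrite ger_pMl.
  apply: le_trans (cylinder_diam_leX i M).
  exact: cylinder_diam_nincr.
have zF : moran_set z by exists i.
have := H _ _ z r0 rrho rhoC zF.
have -> : tau * L / (tau * L * B ^+ n) = B ^- n.
  by field; rewrite !gt_eqF.
move=> low; rewrite -mulrA ler_pdivlMl// -lee_fin; apply: le_trans low _.
have [//||c [c01 cc csize]] := @piece_cover_le s _ (n + n0) i k r0 s0.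
- by rewrite -/L exprD mulrA mulrAC ler_pM2r// mulrC ler_pM2r// ltW.
apply: (covering_number_le (s := c)).
- by move=> x /c01/itv01.
- apply: seq_coversS cc; apply: subset_trans (@piece_subS i k).
  exact: ball_piece.
apply: le_trans csize _.
rewrite -powRM ?invr_ge0 ?(ltW tauA_gt0) ?(ltW Bn0)//.
have -> : cylinder_diam i k / (A * (tau * L * B ^+ n)) = (tau * A)^-1 * B ^- n.
  by rewrite -/L; field; rewrite !gt_eqF.
rewrite ge_max lexx andbT; apply: powR_ge1 => //.
by rewrite mulr_ege1// invf_ge1.
Qed.

End moran.

(** * Runs in independent sequences *)

Section infinite_product.
Context d (T : measurableType d) (R : realType) (P : probability T R).
Context (PP : probability (sequence_space T) R).
Hypothesis prodPP : is_infinite_product P PP.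
Implicit Types (E : set T) (w : sequence_space T).

Lemma measurable_coordinate n E : measurable E ->
  measurable [set w : sequence_space T | E (w n)].
Proof. by move=> mE; apply: sub_sigma_algebra; exists n, E. Qed.

Definition all_in E n (S : {set 'I_n}) : set (sequence_space T) :=
  [set w | forall k, k \in S -> E (w k)].

Lemma measurable_all_in E n (S : {set 'I_n}) : measurable E ->
  measurable (all_in E S).
Proof.
move=> mE; have -> : all_in E S =
    \bigcap_(k in [set` S]) [set w : sequence_space T | E (w k)].
  by apply/seteqP; split => w /= h k; exact: h.
by apply: fin_bigcap_measurable => // k _; exact: measurable_coordinate.
Qed.

Lemma probability_all_in E n (S : {set 'I_n}) : measurable E ->
  PP (all_in E S) = ((fine (P E)) ^+ #|S|)%:E.
Proof.
move=> mE; pose F (k : 'I_n) := if k \in S then E else setT.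
have -> : all_in E S = [set w | forall k : 'I_n, F k (w k)].
  apply/seteqP; split => w /= h k; rewrite /F.
    by case: ifPn => // /h.
  by move=> kS; have := h k; rewrite /F kS.
rewrite prodPP; last by move=> k; rewrite /F; case: ifP.
rewrite -prodr_const -prodEFin [RHS]big_mkcond/=; apply: eq_bigr => k _.
rewrite /F; case: ifP => _; last exact: probability_setT.
by rewrite fineK// fin_num_measure.
Qed.

Section blocks.
Variables (E : set T) (mE : measurable E) (N M : nat).
Let p : R := fine (P E).

Definition block j : set (sequence_space T) :=
  [set w | forall k, (M + j * N <= k < M + j.+1 * N)%N -> E (w k)].

Definition no_block J : set (sequence_space T) :=
  [set w | forall j, (j < J)%N -> ~ block j w].

Definition block_indices n j : {set 'I_n} :=
  [set k : 'I_n | (M + j * N <= k < M + j.+1 * N)%N].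

Lemma card_block_indices n j : (M + j.+1 * N <= n)%N -> #|block_indices n j| = N.
Proof.
move=> jn.
have kn (k : 'I_N) : (M + j * N + k < n)%N.
  by apply: leq_trans jn; rewrite mulSn addnCA [leqRHS]addnC ltn_add2l.
have -> : block_indices n j = [set Ordinal (kn k) | k : 'I_N].
  apply/setP => k; rewrite inE; apply/idP/imsetP => [/andP[jk kj]|[l _ ->]/=].
    have kN : (k - (M + j * N) < N)%N.
      by rewrite ltn_subLR//; apply: leq_trans kj _; rewrite mulSn addnCA addnC.
    by exists (Ordinal kN) => //; apply/val_inj; rewrite /= subnKC.
  by rewrite leq_addr mulSn addnCA [ltnRHS]addnC ltn_add2l/=.
rewrite card_imset ?card_ord// => k l /(congr1 val)/= /addnI kl.
exact: val_inj.
Qed.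

Lemma measurable_block j : measurable (block j).
Proof.
have -> : block j = all_in E (block_indices (M + j.+1 * N) j).
  apply/seteqP; split => w /= h k.
    by rewrite inE => /h.
  move=> /[dup] kj /andP[_ kn].
  by have := h (Ordinal kn); rewrite inE; exact.
exact: measurable_all_in.
Qed.

Lemma measurable_no_block J : measurable (no_block J).
Proof.
have -> : no_block J = \bigcap_(j in [set j | (j < J)%N]) ~` block j by [].
apply: bigcap_measurableType => j _.
by apply: measurableC; exact: measurable_block.
Qed.

(** The absence of the first J blocks is independent of what happens later, and
    has probability (1 - p^N)^J. Allowing an extra event on later coordinates
    makes the induction on J work: the J-th block is absent on the difference
    of two events of this form, with sets of indices S and S :|: b. *)
Lemma probability_no_block_all_in J n (S : {set 'I_n}) : (M + J * N <= n)%N ->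
    (forall k, k \in S -> (M + J * N <= k)%N) ->
  PP (no_block J `&` all_in E S) = ((1 - p ^+ N) ^+ J * p ^+ #|S|)%:E.
Proof.
elim: J n S => [|J IH] n S Jn JS.
  rewrite expr0 mul1r -probability_all_in//; congr (PP _).
  by apply/seteqP; split => w /= => [[]//|h]; split.
have JJ : (M + J * N <= M + J.+1 * N)%N.
  by rewrite leq_add2l leq_mul2r leqnSn orbT.
set b := block_indices n J.
have Sb : all_in E (S :|: b) = all_in E S `&` block J.
  apply/seteqP; split => w /=.
    move=> h; split=> k kS; first by apply: h; rewrite inE kS.
    have kn : (k < n)%N by apply: leq_trans Jn; case/andP: kS.
    by have := h (Ordinal kn); rewrite !inE kS orbT; exact.
  move=> [hS hb] k; rewrite !inE => /orP[/hS//|]; exact: hb.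
have -> : no_block J.+1 `&` all_in E S =
    (no_block J `&` all_in E S) `\` (no_block J `&` all_in E (S :|: b)).
  rewrite Sb; apply/seteqP; split => w /=.
    move=> [nb wS]; split; first by split=> // j jJ; apply: nb; exact: ltnW.
    by move=> [_ [_]]; exact: nb.
  move=> [[nb wS] h]; split=> // j; rewrite ltnS leq_eqVlt => /predU1P[->|/nb//].
  by move=> wJ; apply: h.
have disj : (S :&: b)%SET = finset.set0.
  apply/setP => k; rewrite !inE; apply/negbTE/negP => /andP[/JS kJ].
  by move=> /andP[_]; rewrite ltnNge kJ.
have mX n' (S' : {set 'I_n'}) : measurable (no_block J `&` all_in E S').
  by apply: measurableI; [exact: measurable_no_block|exact: measurable_all_in].
have -> :
    PP ((no_block J `&` all_in E S) `\` (no_block J `&` all_in E (S :|: b))) =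
    (PP (no_block J `&` all_in E S) - PP (no_block J `&` all_in E (S :|: b)))%E.
  rewrite measureD//; last by rewrite ltey_eq fin_num_measure//; exact: mX.
  congr (_ - PP _)%E; rewrite setIidr// Sb => w [nb []]; split=> //.
have JS' k : k \in S -> (M + J * N <= k)%N by move=> /JS; exact: leq_trans JJ.
have JSb k : k \in (S :|: b)%SET -> (M + J * N <= k)%N.
  by rewrite !inE => /orP[/JS'|/andP[]].
rewrite (IH n S (leq_trans JJ Jn) JS') (IH n _ (leq_trans JJ Jn) JSb).
rewrite cardsU disj cards0 subn0 card_block_indices//.
by rewrite -EFinB exprS exprD; congr EFin; ring.
Qed.

Lemma ae_some_block : (0 < P E)%E -> {ae PP, forall w, exists j, block j w}.
Proof.
move=> E0; have p0 : 0 < p.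
  by rewrite fine_gt0// E0 -ge0_fin_numE// fin_num_measure.
have p1 : p <= 1 by rewrite -lee_fin fineK ?fin_num_measure// probability_le1.
have q0 : 0 < p ^+ N by rewrite exprn_gt0.
have q1 : p ^+ N <= 1 by rewrite exprn_ile1// ltW.
exists (\bigcap_j ~` block j); split.
- by apply: bigcapT_measurable => j; apply: measurableC; exact: measurable_block.
- apply/eqP; rewrite -measure_le0; apply/lee_addgt0Pr => e e0; rewrite add0e.
  have [||J Je] := @expr_small R (1 - p ^+ N) e _ _ e0.
  + by rewrite subr_ge0.
  + by rewrite ltrBlDr ltrDl.
  apply: (@le_trans _ _ (PP (no_block J))); last first.
    have := @probability_no_block_all_in J (M + J * N) finset.set0 (leqnn _).
    rewrite cards0 expr0 mulr1 => H; rewrite -[no_block J]setIT.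
    rewrite (_ : setT = all_in E (finset.set0 : {set 'I_(M + J * N)})).
      rewrite H ?lee_fin ?ltW// => k; by rewrite inE.
    by apply/seteqP; split=> // w _ k; rewrite inE.
  apply: le_measure; rewrite ?inE.
  + apply: bigcapT_measurable => j.
    by apply: measurableC; exact: measurable_block.
  + exact: measurable_no_block.
  + by move=> w h j _; exact: h.
- by move=> w /= h j _ wj; apply: h; exists j.
Qed.

End blocks.

Lemma ae_long_runs E : measurable E -> (0 < P E)%E ->
  {ae PP, forall w, forall N M, exists2 k, (M <= k)%N &
     forall l, (k <= l < k + N)%N -> E (w l)}.
Proof.
move=> mE E0; apply: ae_foralln => N; apply: ae_foralln => M.
apply: filterS (@ae_some_block E mE N M E0) => w [j wj].
by exists (M + j * N)%N; rewrite ?leq_addr// => l; rewrite -addnA -mulSnr => /wj.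
Qed.

Lemma ae_all_coordinates (Q : T -> Prop) : {ae P, forall x, Q x} ->
  {ae PP, forall w, forall n, Q (w n)}.
Proof.
move=> [E [mE E0 QE]]; apply: ae_foralln => n.
exists [set w : sequence_space T | E (w n)]; split.
- exact: measurable_coordinate.
- have := @probability_all_in E n.+1 [set ord_max]%SET mE.
  rewrite cards1 expr1 E0 => /= H; rewrite -[RHS]H.
  congr (PP _); apply/seteqP; split => w /=.
    by move=> wE k; rewrite inE => /eqP ->.
  by move=> h; apply: (h ord_max); rewrite inE.
- by move=> w /= h; apply: QE.
Qed.

End infinite_product.

(** * Realizations of the random system *)

Section random_moran.
Context d (T : measurableType d) (R : realType) (P : probability T R).
Context (K : nat) (A B tau : R) (I : random_weighted_ifs P K A B tau).
Hypotheses (A0 : 0 < A) (B1 : B < 1) (tau0 : 0 < tau) (tau1 : tau <= 1).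
Hypothesis K0 : (0 < K)%N.
Implicit Types w : sequence_space T.

Let f w k j := ifs_map I j (w k).

(** The big operator peels off the outermost map, the definition by recursion
    the innermost one. *)
Lemma big_comp_cylinder_map (g : nat -> 'I_K -> R -> R) (i : nat -> 'I_K) n :
  \big[(fun f g : R -> R => f \o g)/idfun]_(k < n) g k (i k)
  = cylinder_map g i n.
Proof.
have shift (h : nat -> 'I_K -> R -> R) (l : nat -> 'I_K) m :
    cylinder_map h l m.+1 =
    h 0 (l 0) \o cylinder_map (fun k => h k.+1) (fun k => l k.+1) m.
  by elim: m => [//|m IH]; rewrite /= in IH *; rewrite IH.
elim: n g i => [|n IH] g i; first by rewrite big_ord0.
rewrite big_ord_recl shift; congr (_ \o _).
exact: (IH (fun k => g k.+1) (fun k => i k.+1)).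
Qed.

Lemma word_mapE w n (u : n.-tuple 'I_K) (j0 : 'I_K) :
  word_map I w u = cylinder_map (f w) (nth j0 u) n.
Proof.
rewrite -big_comp_cylinder_map; apply: eq_bigr => k _.
by rewrite /f (tnth_nth j0).
Qed.

Let itv01 : `[0, 1]%classic = [set x : R | 0 <= x <= 1].
Proof. by apply/seteqP; split => x /=; rewrite in_itv. Qed.

Lemma random_moran_construction w :
  moran_construction A B tau (f w) (fun k j => ifs_ratio I j (w k)).
Proof.
split=> //.
- move=> k j x x01; have := @ifs_map_itv _ _ _ _ _ _ _ _ I j (w k).
  by rewrite itv01 => H; apply: H; exists x.
- by move=> k j x y x01 y01; apply: ifs_map_similarity; rewrite itv01.
- by move=> k j; exact: ifs_ratio_ge.
- by move=> k; exact: ifs_ratio_sum_le.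
- by move=> k j j' x y jj' x01 y01; apply: ifs_map_separated; rewrite ?itv01.
Qed.

Lemma random_moran_setE w : random_moran_set I w = moran_set (f w).
Proof.
have fa := random_moran_construction w.
rewrite (moran_setE fa) /random_moran_set itv01.
apply/seteqP; split => x /= H n.
  (* The intersection starts at length 1, which also settles length 0. *)
  case: n => [|n].
    have [u _ [y y01 yx]] := H 1 isT; exists (fun=> Ordinal K0), x => //.
    rewrite -yx (word_mapE _ _ (Ordinal K0)).
    exact: (moran_map01 fa).
  have [u _ [y y01 yx]] := H n.+1 isT; exists (nth (Ordinal K0) u), y => //.
  by rewrite -word_mapE.
move=> n0; have [i [y y01 yx]] := H n.
exists [tuple i k | k < n] => //; exists y => //.
rewrite -yx (word_mapE _ _ (Ordinal K0)).
congr (_ y); apply: cylinder_map_congr => k kn.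
by rewrite -[k]/(val (Ordinal kn)) -tnth_nth tnth_mktuple.
Qed.

End random_moran.

(** * The similarity dimension and its essential bounds *)

Section similarity_dimension.
Context d (T : measurableType d) (R : realType) (P : probability T R).
Context (K : nat) (A B tau : R) (I : random_weighted_ifs P K A B tau).
Variable simdim : T -> R.
Hypotheses (A0 : 0 < A) (B1 : B < 1).
Hypothesis simdimE : forall x, \sum_(j < K) ifs_ratio I j x `^ simdim x = 1.

Let ratio_sum s x := \sum_(j < K) ifs_ratio I j x `^ s.

Lemma ifs_ratio_lt1 j x : ifs_ratio I j x < 1.
Proof.
apply: le_lt_trans B1.
exact: le_trans (ifs_ratio_le_sum I j x) (ifs_ratio_sum_le I x).
Qed.

Lemma ifs_ratio_gt0 j x : 0 < ifs_ratio I j x.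
Proof. exact: lt_le_trans (ifs_ratio_ge I j x). Qed.

Lemma ratio_sum_nincr x s t : s <= t -> ratio_sum t x <= ratio_sum s x.
Proof.
move=> st; apply: ler_sum => j _; apply: ger_powR => //.
by rewrite ifs_ratio_gt0 ltW// ifs_ratio_lt1.
Qed.

Lemma ratio_sum_le1 x s : simdim x <= s -> ratio_sum s x <= 1.
Proof.
by move=> /(ratio_sum_nincr x) /le_trans; apply; rewrite /ratio_sum simdimE.
Qed.

Lemma ratio_sum_ge1 x s : s <= simdim x -> 1 <= ratio_sum s x.
Proof. by move=> /(ratio_sum_nincr x); rewrite {1}/ratio_sum simdimE. Qed.

(** The power sum with exponent 1 is at most B < 1. *)
Lemma simdim_le1 x : simdim x <= 1.
Proof.
rewrite leNgt; apply/negP => /ltW /ratio_sum_ge1; apply/negP; rewrite -ltNge.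
apply: le_lt_trans B1; apply: le_trans (ifs_ratio_sum_le I x).
by apply: ler_sum => j _; rewrite powRr1// ltW// ifs_ratio_gt0.
Qed.

Lemma measurable_ratio_sum s : measurable_fun setT (ratio_sum s).
Proof.
apply: measurable_sum => j.
by apply: (measurableT_comp (measurable_powR s)); exact: measurable_funP.
Qed.

Lemma measurable_ratio_sum_ge s : measurable [set x | 1 <= ratio_sum s x].
Proof.
have := measurable_ratio_sum s measurableT (measurable_itv `[1, +oo[).
rewrite setTI (_ : _ @^-1` _ = [set x | 1 <= ratio_sum s x])//.
by apply/seteqP; split => x /=; rewrite in_itv/= andbT.
Qed.

Lemma measurable_ratio_sum_le s : measurable [set x | ratio_sum s x <= 1].
Proof.
have := measurable_ratio_sum s measurableT (measurable_itv `]-oo, 1]).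
rewrite setTI (_ : _ @^-1` _ = [set x | ratio_sum s x <= 1])//.
Qed.

Lemma ess_sup_simdim_fin : (forall x, 0 <= simdim x) ->
  exists2 D, 0 <= D & ess_sup P (EFin \o simdim) = D%:E.
Proof.
move=> s0; have P0 : (0 < P setT)%E by rewrite probability_setT.
have h0 : (0 <= ess_sup P (EFin \o simdim))%E by apply: ess_sup_ger.
have h1 : (ess_sup P (EFin \o simdim) <= 1%:E)%E.
  by apply: ess_sup_ler => x; rewrite lee_fin simdim_le1.
by case: (ess_sup _ _) h0 h1 => [D| |]//; exists D.
Qed.

Lemma ess_inf_simdim_fin : (forall x, 0 <= simdim x) ->
  exists2 D, 0 <= D & ess_inf P (EFin \o simdim) = D%:E.
Proof.
move=> s0; have P0 : (0 < P setT)%E by rewrite probability_setT.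
have h0 : (0 <= ess_inf P (EFin \o simdim))%E.
  by apply/ess_infP; apply: nearW => x; rewrite lee_fin.
have h1 : (ess_inf P (EFin \o simdim) <= 1%:E)%E.
  rewrite -(ess_inf_cst (1%:E : \bar R) P0).
  by apply: le_ess_inf; apply: nearW => x; rewrite lee_fin simdim_le1.
by case: (ess_inf _ _) h0 h1 => [D| |]//; exists D.
Qed.

(** The event is that simdim x is at least s; written with the power sum, it is
    measurable because the ratios are. *)
Lemma probability_ratio_sum_ge_gt0 s :
  (s%:E < ess_sup P (EFin \o simdim))%E ->
  (0 < P [set x | (1 <= ratio_sum s x)%R])%E.
Proof.
move=> sD; rewrite lt0e measure_ge0 andbT; apply/eqP => P0; move: sD.
rewrite ltNge => /negP; apply; apply/ess_supP.
exists [set x | 1 <= ratio_sum s x]; split => //.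
  exact: measurable_ratio_sum_ge.
move=> x /= /negP; rewrite lee_fin -ltNge => /ltW; exact: ratio_sum_ge1.
Qed.

Lemma probability_ratio_sum_le_gt0 s :
  (ess_inf P (EFin \o simdim) < s%:E)%E ->
  (0 < P [set x | (ratio_sum s x <= 1)%R])%E.
Proof.
move=> sD; rewrite lt0e measure_ge0 andbT; apply/eqP => P0; move: sD.
rewrite ltNge => /negP; apply; apply/ess_infP.
exists [set x | ratio_sum s x <= 1]; split => //.
  exact: measurable_ratio_sum_le.
move=> x /= /negP; rewrite lee_fin -ltNge => /ltW; exact: ratio_sum_le1.
Qed.

End similarity_dimension.

(** * Almost sure Assouad dimensions *)

Theorem corollary7 (R : realType) (disp : measure_display)
    (Omega0 : measurableType disp) (P : probability Omega0 R)
    (PP : probability (sequence_space Omega0) R)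
    (K : nat) (A B tau : R)
    (I : random_weighted_ifs P K A B tau) (simdim : Omega0 -> R)
    (hPP : is_infinite_product P PP)
    (hK : (2 <= K)%N) (hA : 0 < A) (hB : 0 < B) (htau : 0 < tau)
    (hKA : 0 < K%:R * A) (hKAB : K%:R * A <= B) (hB1 : B < 1)
    (htauB : tau <= (1 - B) / K%:R)
    (hsimdim0 : forall w, 0 <= simdim w)
    (hsimdim : forall w, \sum_(j < K) ifs_ratio I j w `^ simdim w = 1) :
  {ae PP, forall w,
    upper_assouad_dim `[0, 1] (random_moran_set I w)
      = ess_sup P (EFin \o simdim) /\
    lower_assouad_dim `[0, 1] (random_moran_set I w)
      = ess_inf P (EFin \o simdim)}.
Proof.
have K0 : (0 < K)%N by exact: ltnW.
have tau1 : tau <= 1.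
  apply: le_trans htauB _; rewrite ler_pdivrMr ?ltr0n// mul1r.
  have : (1 : R) <= K%:R by rewrite ler1n.
  lra.
have [D D0 DE] := ess_sup_simdim_fin hA hB1 hsimdim hsimdim0.
have [d d0 dE] := ess_inf_simdim_fin hA hB1 hsimdim hsimdim0.
have aeD : {ae P, forall x, \sum_(j < K) ifs_ratio I j x `^ D <= 1}.
  apply: filterS (ess_sup_ge P (EFin \o simdim)) => x; rewrite DE lee_fin.
  exact: (ratio_sum_le1 hA hB1 hsimdim).
have aed : {ae P, forall x, 1 <= \sum_(j < K) ifs_ratio I j x `^ d}.
  apply: filterS (ess_inf_le P (EFin \o simdim)) => x; rewrite dE lee_fin.
  exact: (ratio_sum_ge1 hA hB1 hsimdim).
(* The exponents are truncated at 0 to stay nonnegative; with exponent 0 the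
   power sum is K. *)
have ae_runs_ge n : {ae PP, forall w, forall N M, exists2 k, (M <= k)%N &
    forall l, (k <= l < k + N)%N ->
      1 <= \sum_(j < K) ifs_ratio I j (w l) `^ Num.max 0 (D - n.+1%:R^-1)}.
  apply: (ae_long_runs hPP (measurable_ratio_sum_ge I _)).
  have [h|h] := leP (D - n.+1%:R^-1) 0.
    rewrite [X in P X](_ : _ = setT) ?probability_setT//.
    apply/seteqP; split=> // x _ /=.
    under eq_bigr do rewrite powRr0.
    by rewrite sumr_const card_ord ler1n.
  apply: (probability_ratio_sum_ge_gt0 hA hB1 hsimdim).
  by rewrite DE lte_fin ltrBlDr ltrDl invr_gt0.
have ae_runs_le n : {ae PP, forall w, forall N M, exists2 k, (M <= k)%N &
    forall l, (k <= l < k + N)%N ->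
      \sum_(j < K) ifs_ratio I j (w l) `^ (d + n.+1%:R^-1) <= 1}.
  apply: (ae_long_runs hPP (measurable_ratio_sum_le I _)).
  apply: (probability_ratio_sum_le_gt0 hA hB1 hsimdim).
  by rewrite dE lte_fin ltrDl invr_gt0.
move: aeD aed ae_runs_ge ae_runs_le.
move=> /(ae_all_coordinates hPP) aeD /(ae_all_coordinates hPP) aed.
move=> /ae_foralln ae_runs_ge /ae_foralln ae_runs_le.
rewrite DE dE.
apply: filterS (filterI (filterI aeD aed) (filterI ae_runs_ge ae_runs_le)).
move=> w [[sumD sumd] [runs_ge runs_le]].
have fa := random_moran_construction I hA hB1 htau tau1 K0 w.
rewrite (random_moran_setE I hA hB1 htau tau1 K0).
split; apply/eqP; rewrite eq_le; apply/andP; split.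
- exact: (upper_assouad_dim_le fa).
- apply/lee_addgt0Pr => e e0; have [n ne] := ltr_add_invr e0.
  rewrite add0r in ne.
  apply: (@le_trans _ _ ((Num.max 0 (D - n.+1%:R^-1))%:E + e%:E)%E).
    rewrite -EFinD lee_fin -lerBlDr le_max; apply/orP; right.
    by rewrite lerD2l lerN2 ltW.
  rewrite leeD2r//; apply: (upper_assouad_dim_ge fa); last exact: runs_ge.
  by rewrite le_max lexx.
- apply/lee_addgt0Pr => e e0; have [n ne] := ltr_add_invr e0.
  rewrite add0r in ne.
  apply: (@le_trans _ _ (d + n.+1%:R^-1)%:E); last first.
    by rewrite -EFinD lee_fin lerD2l ltW.
  apply: (lower_assouad_dim_le fa); last exact: runs_le.
  by rewrite addr_ge0.
- exact: (lower_assouad_dim_ge fa).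
Qed.
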